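(* For every metric space $X$ the following are equivalent: (a) $X\times Y$ is straight for every straight space $Y$; (b) $X\times Y$ is straight for every complete straight space $Y$; (c) $X\times C$ and $X\times\mathbb{N}$ are straight, where $C$ is the Cantor space; (d) $X$ is precompact and ULC.
   Context: All spaces are metric. A metric space $X$ is straight if whenever $X$ is the union of finitely many closed sets, a continuous function $f\colon X\to\mathbb{R}$ is uniformly continuous if and only if its restriction to each of these closed sets is uniformly continuous. A metric space $X$ is uniformly locally connected (ULC) if for every $\varepsilon>0$ there is $\delta>0$ such that any two points of $X$ at distance $<\delta$ lie in a connected subset of $X$ of diameter $<\varepsilon$. Precompact means totally bounded (equivalently, the metric completion is compact). The product $X\times Y$ carries the metric $d((x,y),(x',y'))=d_X(x,x')+d_Y(y,y')$. $\mathbb{N}$ carries its usual (uniformly discrete) metric. *)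

(* Defs.v *)
From HB Require Import structures.
From mathcomp Require Import all_boot all_order all_algebra.
From mathcomp Require Import all_classical all_reals all_analysis.

Set Implicit Arguments.
Unset Strict Implicit.
Unset Printing Implicit Defensive.

Import Order.TTheory GRing.Theory Num.Theory.
Import numFieldNormedType.Exports.

Local Open Scope classical_set_scope.
Local Open Scope ring_scope.

(* The library's product X * Y carries the sup metric, hence an alias. *)
Definition sum_prod (R : realType) (X Y : metricType R) : Type := (X * Y)%type.

Section SumProd.
Context {R : realType} (X Y : metricType R).

Definition sum_dist (p q : sum_prod X Y) : R :=
  mdist p.1 q.1 + mdist p.2 q.2.

Let sum_distxx p : sum_dist p p = 0.
Proof. by rewrite /sum_dist !mdistxx addr0. Qed.

Let sum_dist_positivity p q : sum_dist p q = 0 -> p = q.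
Proof.
case: p q => [x y] [x' y'] /eqP; rewrite /sum_dist paddr_eq0 ?mdist_ge0//=.
by move=> /andP[/eqP/mdist_positivity-> /eqP/mdist_positivity->].
Qed.

Let sum_dist_sym p q : sum_dist p q = sum_dist q p.
Proof. by rewrite /sum_dist metric_sym (metric_sym p.2). Qed.

Let sum_dist_triangle q p r : sum_dist p r <= sum_dist p q + sum_dist q r.
Proof. by rewrite /sum_dist addrACA lerD// metric_triangle. Qed.

HB.instance Definition _ := Choice.copy (sum_prod X Y) (X * Y)%type.
HB.instance Definition _ := isMetric.Build R (sum_prod X Y)
  sum_distxx sum_dist_positivity sum_dist_sym sum_dist_triangle.

End SumProd.

(* nat with the distance |m - n|; the library only makes nat a pseudometric
   space, whose balls are singletons whatever the radius. *)
Definition metric_nat (R : realType) : Type := nat.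

Section MetricNat.
Context {R : realType}.

Definition nat_dist (m n : metric_nat R) : R := `|(m : nat)%:R - (n : nat)%:R|.

Let nat_distxx m : nat_dist m m = 0.
Proof. by rewrite /nat_dist subrr normr0. Qed.

Let nat_dist_positivity m n : nat_dist m n = 0 -> m = n.
Proof. by move=> /normr0_eq0/eqP; rewrite subr_eq0 eqr_nat => /eqP. Qed.

Let nat_dist_sym m n : nat_dist m n = nat_dist n m.
Proof. exact: distrC. Qed.

Let nat_dist_triangle n m p : nat_dist m p <= nat_dist m n + nat_dist n p.
Proof. exact: ler_distD. Qed.

HB.instance Definition _ := Choice.copy (metric_nat R) nat.
HB.instance Definition _ := isMetric.Build R (metric_nat R)
  nat_distxx nat_dist_positivity nat_dist_sym nat_dist_triangle.

End MetricNat.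

(* The library's cantor_space (bool^nat with the product topology) is not a
   metricType; here it gets the metric 2^-n, n the least index at which two
   sequences differ.  By compactness all compatible metrics on it are uniformly
   equivalent. *)
Definition metric_cantor (R : realType) : Type := cantor_space.

Section MetricCantor.
Context {R : realType}.
Implicit Types x y z : metric_cantor R.

Definition cantor_dist x y : R :=
  if pselect (exists n, x n != y n) is left h then 2^-1 ^+ ex_minn h else 0.

Lemma cantor_dist_ge x y n : x n != y n -> 2^-1 ^+ n <= cantor_dist x y.
Proof.
rewrite /cantor_dist; case: pselect => [h xyn|/forallNP/(_ n)/negP/negPn/eqP->].
  case: ex_minnP => m _ /(_ n xyn) mn.
  by rewrite ler_wiXn2l// ?invf_le1 ?ler1n.
by rewrite eqxx.
Qed.

Lemma cantor_dist_le x y n :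
  (forall i, (i < n)%N -> x i = y i) -> cantor_dist x y <= 2^-1 ^+ n.
Proof.
rewrite /cantor_dist => xy; case: pselect => [h|_]; last by rewrite exprn_ge0.
case: ex_minnP => m xym _; rewrite ler_wiXn2l// ?invf_le1 ?ler1n//.
by rewrite leqNgt; apply: contra xym => /xy ->.
Qed.

Lemma cantor_dist_ge0 x y : 0 <= cantor_dist x y.
Proof. by rewrite /cantor_dist; case: pselect => // h; rewrite exprn_ge0. Qed.

Let cantor_distxx x : cantor_dist x x = 0.
Proof.
rewrite /cantor_dist; case: pselect => // h; exfalso.
by case: h => n; rewrite eqxx.
Qed.

Let cantor_dist_positivity x y : cantor_dist x y = 0 -> x = y.
Proof.
move=> xy0; apply/funext => n; apply/eqP; apply: contraT => /cantor_dist_ge.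
by rewrite xy0 leNgt exprn_gt0.
Qed.

Let cantor_dist_sym x y : cantor_dist x y = cantor_dist y x.
Proof.
have dist_le u v : cantor_dist u v <= cantor_dist v u.
  rewrite {1}/cantor_dist; case: pselect => [h|_]; last exact: cantor_dist_ge0.
  by case: ex_minnP => n uvn _; rewrite cantor_dist_ge// eq_sym.
by apply/eqP; rewrite eq_le !dist_le.
Qed.

Let cantor_dist_triangle y x z :
  cantor_dist x z <= cantor_dist x y + cantor_dist y z.
Proof.
rewrite {1}/cantor_dist; case: pselect => [h|_]; last first.
  by rewrite addr_ge0 ?cantor_dist_ge0.
case: ex_minnP => n xzn _; have [xyn|xyn] := eqVneq (x n) (y n).
  by rewrite ler_wpDl ?cantor_dist_ge0// cantor_dist_ge// -xyn.
by rewrite ler_wpDr ?cantor_dist_ge0// cantor_dist_ge.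
Qed.

HB.instance Definition _ := Choice.copy (metric_cantor R) cantor_space.
HB.instance Definition _ := isMetric.Build R (metric_cantor R)
  cantor_distxx cantor_dist_positivity cantor_dist_sym cantor_dist_triangle.

Lemma nbhs_metric_cantorE (x : cantor_space) :
  @nbhs _ (metric_cantor R) x = @nbhs _ cantor_space x.
Proof.
apply/seteqP; split=> A.
  move=> /(nbhs_ballP (x : metric_cantor R))[e /= e0 xeA].
  have [n ne] : exists n, (2^-1 : R) ^+ n < e.
    have /cvgrPdist_lt/(_ _ e0)[n _ /(_ n (leqnn n))/=] :
        (2^-1 : R) ^+ n @[n --> \oo] --> 0.
      by apply: cvg_expr; rewrite ger0_norm// invf_lt1 ?ltr1n.
    by rewrite sub0r normrN ger0_norm ?exprn_ge0// => ?; exists n.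
  have : \forall y \near x, forall i : 'I_n, x i = (y : cantor_space) i.
    apply: (@filter_forall _ _ (fun i y => x (val i) = y (val i)) _
      (nbhs_filter x)) => i.
    have : nbhs x (proj (i : nat) @^-1` [set x i]).
      by apply: proj_continuous; exact: discrete_set1.
    by apply: filterS => y.
  apply: filterS => y xy; apply: xeA; rewrite ballEmdist /=.
  apply: le_lt_trans ne; apply: cantor_dist_le => i ni.
  exact: (xy (Ordinal ni)).
suff : {ptws, @nbhs _ (metric_cantor R) x --> (x : nat -> bool)} by apply.
apply/pointwise_cvgP => n A0 /nbhs_singleton A0xn.
have n0 : 0 < (2^-1 : R) ^+ n by rewrite exprn_gt0.
apply: filterS (nbhsx_ballx (x : metric_cantor R) _ n0) => y.
rewrite ballEmdist/= ltNge => /negP xyn; have <- // : x n = y n.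
by apply/eqP; apply: contrapT => /negP/cantor_dist_ge.
Qed.

End MetricCantor.

Section Notions.
Context {R : realType}.

(* Two distinct points of subspace A are uniformly close only if both lie in A,
   so points outside A do not affect unif_continuous (from_subspace A f). *)
Definition straight (X : metricType R) : Prop :=
  forall (n : nat) (F : 'I_n -> set X),
    (forall i, closed (F i)) -> \bigcup_i F i = [set: X] ->
    forall f : X -> R, continuous f ->
      unif_continuous f <->
      forall i, unif_continuous (from_subspace (F i) f).

Definition diameter (X : metricType R) (A : set X) : \bar R :=
  ereal_sup [set (mdist x y)%:E | x in A & y in A].

Definition uniformly_locally_connected (X : metricType R) : Prop :=
  forall eps : R, 0 < eps -> exists2 delta : R, 0 < delta &
    forall x y : X, mdist x y < delta ->
      exists A : set X,
        [/\ connected A, A x, A y & (diameter A < eps%:E)%E].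

(* The library's precompact means relatively compact instead. *)
Definition totally_bounded (X : metricType R) : Prop :=
  forall eps : R, 0 < eps ->
    exists2 S : set X, finite_set S & \bigcup_(x in S) ball x eps = [set: X].

(* The library's completeType is restricted to pointed spaces. *)
Definition metric_complete (X : metricType R) : Prop :=
  forall F : set_system X, ProperFilter F -> cauchy F ->
    exists x : X, F --> x.

End Notions.

(* Main.v *)
From HB Require Import structures.
Require Import Defs.
From mathcomp Require Import all_boot all_order all_algebra.
From mathcomp Require Import all_classical all_reals all_analysis.
From mathcomp Require Import lra.

Set Implicit Arguments.
Unset Strict Implicit.
Unset Printing Implicit Defensive.

Import Order.TTheory GRing.Theory Num.Theory.
Import numFieldNormedType.Exports.

Local Open Scope classical_set_scope.
Local Open Scope ring_scope.

(** The product of a totally bounded ULC space X with a straight space Y is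
straight because uniform continuity of f can be checked one variable at a time.
Along X, two close points lie in a small connected set K; its slice K * {y} is
covered by the n closed sets of the given cover, on each of which f varies
little, and by connectedness f varies at most n times as much on the whole
slice ([connected_image_le]).  The resulting modulus does not depend on y
([ulc_equicontinuous]).  Hence, X being totally bounded, all the slices
f(x, _) are uniformly approximated by finitely many f(s, _), and these are
uniformly continuous because Y is straight ([straight_slice]); this is
[straight_prod].

Conversely, in a straight space a cover by two closed sets A and B is u-placed:
points of A and B that are close to each other are close to the intersection of
A and B ([straight_uplaced]).  Otherwise the function equal to a truncated
distance to this intersection on A, and to 0 on B, would contradict
straightness.  Two such covers carry the necessity of the conditions on X.
- If X is not totally bounded, it contains an infinite separated sequence z.
  Let C be the Cantor space.  The n-th digit of the point of C splits the part
  of X * C over a ball around z n into two clopen pieces.  Two closed sets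
  extending these pieces for all n meet only outside these parts, but come as
  close as 2^-n to each other above z n ([totally_bounded_of_straight_cantor]).
- The space X * nat records a sequence of closed covers of X, so when it is
  straight, all closed covers of X are u-placed with a common modulus.  Applied
  to the clopen splittings of balls, this says that close points x, y lie in the
  same quasi-component of a small ball around x.  Quasi-components of open sets
  are then open, and an open quasi-component is connected
  ([ulc_of_straight_nat]).

Both C and nat are complete and straight, which closes the circle. *)

(** * Uniform continuity and straightness in terms of the distance *)

Section UniformContinuity.
Context {R : realType} (X : metricType R).
Implicit Types (A : set X) (f : X -> R).

Definition uc_on A f := forall e : R, 0 < e -> exists2 d : R, 0 < d &
  forall x y, A x -> A y -> mdist x y < d -> `|f x - f y| < e.

Lemma unif_continuous_withinP A f :
  unif_continuous (from_subspace A f) <-> uc_on A f.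
Proof.
split=> [/unif_continuousP ucf e e0|ucf].
  have [d d0 fd] := ucf e e0; exists d => // x y Ax Ay xyd.
  apply: (fd (x, y)); rewrite ball_subspace_ball /subspace_ball.
  by case: ifP => /asboolP //= _; split => //; rewrite ballEmdist.
apply/unif_continuousP => e e0; have [d d0 fd] := ucf e e0; exists d => //.
move=> [x y]; rewrite ball_subspace_ball /subspace_ball /=.
case: ifP => /asboolP.
  by move=> Ax [Ay]; rewrite ballEmdist; exact: fd.
by move=> _ ->; exact: ballxx.
Qed.

Lemma unif_continuousTP f : unif_continuous f <-> uc_on setT f.
Proof.
split=> [/unif_continuousP ucf e e0|ucf].
  have [d d0 fd] := ucf e e0; exists d => // x y _ _ xyd.
  by apply: (fd (x, y)); rewrite ballEmdist.
apply/unif_continuousP => e e0; have [d d0 fd] := ucf e e0; exists d => //.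
by move=> [x y]; rewrite /= ballEmdist => xyd; exact: fd.
Qed.

Lemma uc_on_sub A B f : A `<=` B -> uc_on B f -> uc_on A f.
Proof.
move=> AB ucf e /ucf[d d0 fd]; exists d => // x y /AB + /AB; exact: fd.
Qed.

Lemma continuousP_mdist f : continuous f <->
  forall x e, 0 < e -> exists2 d : R, 0 < d &
    forall y, mdist x y < d -> `|f x - f y| < e.
Proof.
split=> [cf x e e0|cf x].
  have /cvgrPdist_lt/(_ _ e0)/nbhs_ballP[d /= d0 fd] := cf x.
  by exists d => // y xyd; apply: fd; rewrite ballEmdist.
apply/cvgrPdist_lt => e e0; have [d d0 fd] := cf x e e0.
by apply/nbhs_ballP; exists d => //= y; rewrite ballEmdist; exact: fd.
Qed.

Lemma openP_mdist A : open A <->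
  forall x, A x -> exists2 d : R, 0 < d & forall y, mdist x y < d -> A y.
Proof.
rewrite openE; split=> oA x /oA.
  move=> /nbhs_ballP[d /= d0 xA]; exists d => // y xy; apply: xA.
  by rewrite ballEmdist.
case=> d d0 xA; apply/nbhs_ballP; exists d => //= y; rewrite ballEmdist.
exact: xA.
Qed.

(** The converse implication in the definition of straightness, from f uniformly
continuous to its restrictions, holds in every space. *)
Lemma straightP : straight X <->
  forall (n : nat) (F : 'I_n -> set X),
    (forall i, closed (F i)) -> \bigcup_i F i = [set: X] ->
    forall f : X -> R, continuous f -> (forall i, uc_on (F i) f) ->
      uc_on setT f.
Proof.
split=> sX n F cF FT f cf.
  move=> ucf; apply/unif_continuousTP/(sX n F cF FT f cf) => i.
  exact/unif_continuous_withinP.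
split=> [/unif_continuousTP ucf i|ucf].
  by apply/unif_continuous_withinP; exact: uc_on_sub ucf.
apply/unif_continuousTP/(sX n F cF FT f cf) => i.
exact/unif_continuous_withinP.
Qed.

End UniformContinuity.

Lemma open_mball {R : realType} (X : metricType R) (x : X) (r : R) :
  open (ball x r).
Proof.
apply/openP_mdist => y; rewrite ballEmdist /= => xy.
exists (r - mdist x y) => [|z yz]; first by rewrite subr_gt0.
by have := metric_triangle x y z; rewrite /=; lra.
Qed.

Lemma mdist_sumE {R : realType} (X Y : metricType R) (p q : sum_prod X Y) :
  mdist p q = mdist p.1 q.1 + mdist p.2 q.2.
Proof. by []. Qed.

(** * Closed covers of a straight space are u-placed *)

Section UPlaced.
Context {R : realType} (X : metricType R).
Implicit Types (A B : set X) (f : X -> R).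

Lemma uc_on_glue A B f : closed A -> closed B -> A `|` B = setT ->
  uc_on A f -> uc_on B f -> continuous f.
Proof.
move=> cA cB AB ucA ucB; apply/continuousP_mdist => x e e0.
have near_on D : closed D -> uc_on D f -> exists2 d : R, 0 < d &
    forall y, D y -> mdist x y < d -> `|f x - f y| < e.
  move=> cD ucD; have [Dx|Dx] := pselect (D x).
    by have [d d0 fd] := ucD e e0; exists d => // y Dy; exact: fd.
  have /openP_mdist/(_ x Dx)[d d0 xD] := closed_openC cD.
  by exists d => // y Dy /xD.
have [a a0 fa] := near_on A cA ucA; have [b b0 fb] := near_on B cB ucB.
exists (Num.min a b) => [|y]; rewrite lt_min ?a0// => /andP[ya yb].
have : (A `|` B) y by rewrite AB.
by case=> [Ay|By]; [exact: fa|exact: fb].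
Qed.

(** Adding e to the set of distances truncates the distance to A, and gives it
the value e, instead of inf set0 = 0, when A is empty. *)
Definition trunc_dist A (e : R) (x : X) :=
  inf (e |` [set mdist x c | c in A]).

Lemma trunc_dist_lbound A e x : 0 < e ->
  lbound (e |` [set mdist x c | c in A]) 0.
Proof. by move=> e0 _ [->|[c _ <-]]; [exact: ltW|exact: mdist_ge0]. Qed.

Lemma trunc_dist_ge A e x r : r <= e -> (forall c, A c -> r <= mdist x c) ->
  r <= trunc_dist A e x.
Proof.
move=> re rA; apply: lb_le_inf; first by exists e; left.
by move=> _ [->//|[c Ac <-]]; exact: rA.
Qed.

Lemma trunc_dist_le A e x : 0 < e -> trunc_dist A e x <= e.
Proof.
move=> e0; apply: ge_inf; last by left.
by exists 0; exact: trunc_dist_lbound.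
Qed.

Lemma trunc_dist_le_mdist A e x c : 0 < e -> A c ->
  trunc_dist A e x <= mdist x c.
Proof.
move=> e0 Ac; apply: ge_inf; last by right; exists c.
by exists 0; exact: trunc_dist_lbound.
Qed.

Lemma trunc_dist_lipschitz A e x y : 0 < e ->
  `|trunc_dist A e x - trunc_dist A e y| <= mdist x y.
Proof.
move=> e0.
have le u v : trunc_dist A e u - mdist u v <= trunc_dist A e v.
  apply: trunc_dist_ge => [|c Ac].
    by rewrite lerBlDr ler_wpDr ?mdist_ge0// trunc_dist_le.
  rewrite lerBlDl; apply: le_trans (metric_triangle _ _ _).
  exact: trunc_dist_le_mdist.
by have := le x y; have := le y x; rewrite (metric_sym y x) ler_norml; lra.
Qed.

Lemma uc_on_trunc_dist A B e : 0 < e -> uc_on B (trunc_dist A e).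
Proof.
move=> e0 r r0; exists r => // x y _ _; apply: le_lt_trans.
exact: trunc_dist_lipschitz.
Qed.

Lemma uc_on_eq A f g : {in A, f =1 g} -> uc_on A f -> uc_on A g.
Proof.
move=> fg ucf e /ucf[d d0 fd]; exists d => // x y Ax Ay.
by rewrite -!fg ?inE//; exact: fd.
Qed.

(** Let f be the distance to A `&` B, truncated at e, on A, and 0 on B.  It is
well defined on A `&` B and uniformly continuous on both sets, hence on X.  If x
in A is e-far from A `&` B then f x = e, which is too far from f y = 0 when y in
B is close to x. *)
Lemma straight_uplaced A B : straight X ->
  closed A -> closed B -> A `|` B = setT ->
  forall e : R, 0 < e -> exists2 d : R, 0 < d &
    forall x y, A x -> B y -> mdist x y < d ->
      exists2 c, (A `&` B) c & mdist x c < e.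
Proof.
move=> /straightP sX cA cB AB e e0.
pose f x := if x \in A then trunc_dist (A `&` B) e x else 0.
have fA x : A x -> f x = trunc_dist (A `&` B) e x.
  by move=> Ax; rewrite /f mem_set.
have fB x : B x -> f x = 0.
  move=> Bx; have [Ax|nAx] := pselect (A x); last by rewrite /f memNset.
  rewrite fA//; apply/eqP; rewrite eq_le; apply/andP; split.
    by rewrite -(mdistxx x); exact: trunc_dist_le_mdist.
  by apply: trunc_dist_ge => [|c _]; [exact: ltW|exact: mdist_ge0].
have ucA : uc_on A f.
  apply: uc_on_eq (uc_on_trunc_dist (A `&` B) A e0).
  by move=> x /set_mem Ax; rewrite fA.
have ucB : uc_on B f.
  move=> r r0; exists 1 => // x y Bx By _.
  by rewrite !fB// subrr normr0.
have ucf : uc_on setT f.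
  apply: (sX 2 (fun i => if i == ord0 then A else B)) => [i||| i].
  - by case: ifP.
  - rewrite -AB; apply/seteqP; split=> x.
      by case=> i _; case: ifP; [left|right].
    by case=> [Ax|Bx]; [exists ord0|exists ord_max].
  - exact: uc_on_glue ucA ucB.
  - by case: ifP.
have [d d0 fd] := ucf e e0; exists d => // x y Ax By xyd.
apply: contrapT => noc; have := fd x y I I xyd.
rewrite (fB y)// fA// subr0 ltNge; apply/negP/negPn.
apply: le_trans (ler_norm _); apply: trunc_dist_ge => // c Cc.
by rewrite leNgt; apply/negP => xce; apply: noc; exists c.
Qed.

End UPlaced.

(** * Products with a totally bounded ULC space *)

Section Oscillation.
Context {R : realType}.

(** The image of K is an interval.  If it were longer than n * e, it would contain
n + 1 values in arithmetic progression of step e, two of which would be taken in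
the same F i. *)
Lemma connected_image_le (T : topologicalType) (K : set T) (f : T -> R)
    (n : nat) (F : 'I_n -> set T) (e : R) (x y : T) :
  connected K -> continuous f -> 0 < e -> K `<=` \bigcup_i F i ->
  (forall i u v, (K `&` F i) u -> (K `&` F i) v -> `|f u - f v| < e) ->
  K x -> K y -> `|f x - f y| <= e *+ n.
Proof.
move=> cK cf e0 KF osc; wlog : x y / f x <= f y => [hw|xy] Kx Ky.
  have [/hw|/ltW/hw] := leP (f x) (f y); first exact.
  by rewrite distrC; exact.
rewrite distrC ger0_norm ?subr_ge0// leNgt; apply/negP => big.
have ivl : is_interval (f @` K).
  apply/connected_intervalP/connected_continuous_connected => //.
  exact: continuous_subspaceT.
have pt (k : 'I_n.+1) : exists z, K z /\ f z = f x + e *+ k.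
  have [z Kz fz] : (f @` K) (f x + e *+ k).
    apply: (ivl (f x) (f y)); [by exists x|by exists y|].
    apply/andP; split; first by rewrite lerDl mulrn_wge0// ltW.
    rewrite -lerBrDl (le_trans _ (ltW big))//.
    by rewrite ler_wpMn2l ?ltW// -ltnS.
    by exists z.
have [z /all_and2[Kz fz]] := choice pt.
have idx k : exists i, F i (z k) by have [i _ ?] := KF _ (Kz k); exists i.
have [i Fi] := choice idx.
have /injectivePn[k [l kl ikl]] : ~~ injectiveb i.
  apply/negP => /injectiveP/leq_card; rewrite !card_ord.
  by rewrite ltnn.
have := osc (i k) (z k) (z l).
rewrite {2}ikl => /(_ (conj (Kz k) (Fi k)) (conj (Kz l) (Fi l))).
rewrite !fz opprD addrACA subrr add0r ltNge => /negP; apply.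
wlog kl' : k l kl ikl / (l < k)%N => [hw|].
  move: (kl); rewrite -val_eqE neq_ltn => /orP[|]; last exact: hw.
  by rewrite distrC; apply: hw; rewrite 1?eq_sym.
rewrite -mulrnBr ?(ltnW kl')// ger0_norm ?mulrn_wge0 ?(ltW e0)//.
by rewrite -[leLHS]mulr1n ler_wpMn2l ?(ltW e0)// subn_gt0.
Qed.

End Oscillation.

Lemma finite_modulus {R : realType} (T : choiceType) (S : set T)
    (P : T -> R -> Prop) :
  finite_set S -> (forall s a b, a <= b -> P s b -> P s a) ->
  (forall s, S s -> exists2 d : R, 0 < d & P s d) ->
  exists2 d : R, 0 < d & forall s, S s -> P s d.
Proof.
move=> /finite_seqP[l ->] mono; elim: l => [|s l IHl] Pl.
  by exists 1.
have [|a a0 Pa] := IHl.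
  by move=> t tl; apply: Pl; rewrite /= inE; apply/orP; right.
have [|b b0 Pb] := Pl s; first by rewrite /= inE eqxx.
exists (Num.min a b) => [|t]; first by rewrite lt_min a0.
rewrite /= inE => /orP[/eqP->|tl].
  by apply: mono Pb; rewrite ge_min lexx orbT.
by apply: mono (Pa t tl); rewrite ge_min lexx.
Qed.

Section Sufficiency.
Context {R : realType} (X Y : metricType R).

Lemma continuous_slice (f : sum_prod X Y -> R) (y : Y) :
  continuous f -> continuous (fun x : X => f (x, y)).
Proof.
move=> /continuousP_mdist cf; apply/continuousP_mdist => x e e0.
have [d d0 fd] := cf (x, y) e e0; exists d => // x' xx'; apply: fd.
by rewrite mdist_sumE /= mdistxx addr0.
Qed.

Lemma mdist_diameter (K : set X) (e : R) x y :
  (diameter K < e%:E)%E -> K x -> K y -> mdist x y < e.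
Proof.
move=> Ke Kx Ky; rewrite -lte_fin; apply: le_lt_trans Ke.
by apply: ereal_sup_ubound; exists x => //; exists y.
Qed.

(** Only the oscillation of f on the sets of the cover and the connectedness of
small subsets of X matter, so the modulus d serves for all y at once. *)
Lemma ulc_equicontinuous (n : nat) (F : 'I_n -> set (sum_prod X Y)) f :
  uniformly_locally_connected X -> \bigcup_i F i = setT -> continuous f ->
  (forall i, uc_on (F i) f) ->
  forall e : R, 0 < e -> exists2 d : R, 0 < d &
    forall x x' y, mdist x x' < d -> `|f (x, y) - f (x', y)| < e.
Proof.
move=> ulcX FT cf ucF e e0.
(* n steps of size r must stay strictly below e, also when n = 0 *)
pose r : R := e / n.+1%:R; have r0 : 0 < r by rewrite divr_gt0.
have [d d0 fd] := finite_modulus (@finite_finset _ [set: 'I_n])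
  (P := fun i d => forall p q, F i p -> F i q -> mdist p q < d ->
     `|f p - f q| < r)
  (fun i a b ab Pb p q Fp Fq pq => Pb p q Fp Fq (lt_le_trans pq ab))
  (fun i _ => ucF i r r0).
have [d' d'0 Kd'] := ulcX d d0; exists d' => // x x' y /Kd'[K [cK Kx Kx' Kd]].
have : `|f (x, y) - f (x', y)| <= r *+ n.
  apply: (connected_image_le (F := fun i => [set z | F i (z, y)]) cK
    (continuous_slice cf)) => //.
    by move=> z _; have : (\bigcup_i F i) (z, y) by rewrite FT.
  move=> i u v [Ku Fu] [Kv Fv]; apply: (fd i) => //.
  by rewrite mdist_sumE /= mdistxx addr0; exact: mdist_diameter Kd _ _.
move=> /le_lt_trans; apply.
rewrite -mulr_natr /r -mulrA gtr_pMr// mulrC ltr_pdivrMr// mul1r ltr_nat.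
exact: ltnSn.
Qed.

Lemma straight_slice (n : nat) (F : 'I_n -> set (sum_prod X Y)) f (x : X) :
  straight Y -> (forall i, closed (F i)) -> \bigcup_i F i = setT ->
  continuous f -> (forall i, uc_on (F i) f) ->
  uc_on setT (fun y : Y => f (x, y)).
Proof.
move=> /straightP sY cF FT cf ucF.
have dxx y y' : mdist ((x, y) : sum_prod X Y) (x, y') = mdist y y'.
  by rewrite mdist_sumE /= mdistxx add0r.
apply: (sY n (fun i => [set y | F i (x, y)])) => [i|||i e e0].
- rewrite -openC; apply/openP_mdist => y Fy.
  have /openP_mdist/(_ (x, y) Fy)[d d0 Fd] := closed_openC (cF i).
  by exists d => // y' yy'; apply: Fd; rewrite dxx.
- apply/seteqP; split=> // y _.
  by have : (\bigcup_i F i) (x, y) by rewrite FT.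
- move/continuousP_mdist: cf => cf; apply/continuousP_mdist => y e e0.
  have [d d0 fd] := cf (x, y) e e0; exists d => // y' yy'.
  by apply: fd; rewrite dxx.
- have [d d0 fd] := ucF i e e0; exists d => // y y' Fy Fy' yy'.
  by apply: fd => //; rewrite dxx.
Qed.

(** Pass from (x, y) to (x', y), (s, y), (s, y') and (x', y') with s in a finite
net of X: the three moves along X are controlled by equicontinuity, and the one
along Y by the uniform continuity of finitely many slices. *)
Lemma straight_prod : totally_bounded X -> uniformly_locally_connected X ->
  straight Y -> straight (sum_prod X Y).
Proof.
move=> tbX ulcX sY; apply/straightP => n F cF FT f cf ucF e e0.
have e40 : 0 < e / 4 by rewrite divr_gt0.
have [a a0 fa] := ulc_equicontinuous ulcX FT cf ucF e40.
have [S finS ST] := tbX a a0.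
have [b b0 fb] := finite_modulus finS
  (P := fun s d => forall y y', mdist y y' < d ->
     `|f (s, y) - f (s, y')| < e / 4)
  (fun s c d cd Pd y y' yy' => Pd y y' (lt_le_trans yy' cd))
  (fun s _ => let: ex_intro2 d d0 fd := straight_slice s sY cF FT cf ucF e40 in
     ex_intro2 _ _ d d0 (fun y y' => fd y y' I I)).
exists (Num.min a b) => [|[x y] [x' y'] _ _]; first by rewrite lt_min a0.
rewrite mdist_sumE /= lt_min => /andP[xa yb].
have xx' : mdist x x' < a by apply: le_lt_trans xa; rewrite lerDl mdist_ge0.
have yy' : mdist y y' < b by apply: le_lt_trans yb; rewrite lerDr mdist_ge0.
have [s Ss] : (\bigcup_(s in S) ball s a) x' by rewrite ST.
rewrite ballEmdist /= => sx'.
have := fa x x' y xx'; have := fa s x' y sx'; have := fa s x' y' sx'.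
by have := fb s Ss y y' yy'; rewrite !ltr_norml; lra.
Qed.

End Sufficiency.

(** * The discrete space of natural numbers *)

Section MetricNat.
Context {R : realType}.

Lemma mdist_nat_ge1 (m n : metric_nat R) : m != n -> 1 <= mdist m n.
Proof.
wlog mn : m n / ((m : nat) < (n : nat))%N => [hw mn|_].
  move: (mn); rewrite neq_ltn => /orP[/hw|/hw]; first exact.
  by rewrite metric_sym; apply; rewrite eq_sym.
rewrite /mdist/= /nat_dist distrC ger0_norm ?subr_ge0 ?ler_nat ?(ltnW mn)//.
by rewrite -natrB ?(ltnW mn)// ler1n subn_gt0.
Qed.

Lemma metric_complete_nat : metric_complete (metric_nat R).
Proof.
move=> F FF /(_ [set p | ball p.1 1 p.2]).
case=> [|[A B]/= [FA FB] AB]; first exact: (entourage_ball _ 1%:pos).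
have [n [An Bn]] := filter_ex (filterI FA FB).
have Fn : F [set n].
  apply: filterS FB => m Bm; apply/esym/eqP; apply: contraT => /mdist_nat_ge1.
  have := AB (n, m) (conj An Bm); rewrite /= ballEmdist /= => nm.
  by rewrite leNgt nm.
exists n => V /nbhs_singleton Vn; apply: filterS Fn => _ -> //.
Qed.

Lemma straight_nat : straight (metric_nat R).
Proof.
apply/straightP => n F _ _ f _ _ e e0; exists 1 => // x y _ _.
have [->|/mdist_nat_ge1] := eqVneq x y; first by rewrite subrr normr0.
by rewrite leNgt => /negP.
Qed.

End MetricNat.

(** * The Cantor space *)

Section Cantor.
Context {R : realType}.

Lemma metric_cantor_compact : compact [set: metric_cantor R].
Proof.
move=> F FF FT; have [x [_ Fx]] := @cantor_space_compact F FF FT.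
exists x; split=> // A B FA; rewrite nbhs_metric_cantorE; exact: Fx.
Qed.

(** [compact_cauchy_cvg] is about pointed spaces. *)
HB.instance Definition _ :=
  isPointed.Build (metric_cantor R) (fun=> false).

Lemma metric_complete_cantor : metric_complete (metric_cantor R).
Proof.
move=> F FF cF; apply/cvg_ex.
exact: compact_cauchy_cvg cF filterT metric_cantor_compact.
Qed.

(** Heine-Cantor. *)
Lemma compact_uc_on (X : metricType R) (f : X -> R) :
  compact [set: X] -> continuous f -> uc_on setT f.
Proof.
move=> /compact_near_coveringP cX /continuousP_mdist cf e e0.
have : \forall d \near 0^'+, [set: X] `<=`
    [set x | forall y, mdist x y < d -> `|f x - f y| < e].
  apply: cX => x _.
  have e20 : 0 < e / 2 by rewrite divr_gt0.
  have [d d0 fd] := cf x _ e20.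
  have d20 : 0 < d / 2 by rewrite divr_gt0.
  exists (ball x (d / 2), [set r | r < d / 2]) => /=.
    by split; [exact: nbhsx_ballx|exact: nbhs_right_lt].
  move=> [x' r] /= [+ rd] y x'y; rewrite ballEmdist /= => xx'.
  have xd : mdist x x' < d.
    by apply: lt_trans xx' _; rewrite ltr_pdivrMr// ltr_pMr// ltr1n.
  have yd : mdist x y < d.
    apply: le_lt_trans (metric_triangle _ x' _) _.
    by rewrite [d]splitr ltrD// (lt_trans x'y).
  have := fd x' xd; have := fd y yd; rewrite !ltr_norml; lra.
move=> /(filterI (nbhs_right_gt 0))/filter_ex[d [/= d0 fd]].
by exists d => // x y _ _; exact: fd.
Qed.

Lemma compact_straight (X : metricType R) : compact [set: X] -> straight X.
Proof.
by move=> cX; apply/straightP => n F _ _ f cf _; exact: compact_uc_on.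
Qed.

End Cantor.

(** * Total boundedness and ULC from straight products *)

Section Necessity.
Context {R : realType} (X : metricType R).

(** A point far from all the previous ones can always be added, since finitely
many balls of radius e do not cover X. *)
Lemma separated_sequence : ~ totally_bounded X ->
  exists2 e : R, 0 < e &
    exists z : nat -> X, forall m n, m != n -> e <= mdist (z m) (z n).
Proof.
move=> ntb; apply: contrapT => nsep; apply: ntb => e e0.
apply: contrapT => nocov; apply: nsep; exists e => //.
have far (l : seq X) : exists x, forall s, s \in l -> e <= mdist s x.
  apply: contrapT => nfar; apply: nocov; exists [set` l].
    exact: finite_seq.
  apply/seteqP; split=> // x _; apply: contrapT => nx; apply: nfar.
  exists x => s sl; rewrite leNgt; apply/negP => sx; apply: nx.
  by exists s => //; rewrite ballEmdist.
have [g gfar] := choice far.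
(* l n lists the first n points of the sequence, the last one first *)
pose l n := iter n (fun s => g s :: s) [::].
have gl m n : (m < n)%N -> g (l m) \in l n.
  elim: n => // n IHn; rewrite ltnS leq_eqVlt /= inE => /orP[/eqP->|/IHn->].
    by rewrite eqxx.
  by rewrite orbT.
exists (fun n => g (l n)) => m n; rewrite neq_ltn => /orP[] mn.
  exact/gfar/gl.
by rewrite metric_sym; exact/gfar/gl.
Qed.

Lemma exp_half_lt (e : R) : 0 < e -> exists n, 2^-1 ^+ n < e.
Proof.
move=> e0.
have /cvgrPdist_lt/(_ _ e0)[n _ /(_ n (leqnn n))/=] :
    (2^-1 : R) ^+ n @[n --> \oo] --> 0.
  by apply: cvg_expr; rewrite ger0_norm// invf_lt1 ?ltr1n.
by rewrite sub0r normrN ger0_norm ?exprn_ge0// => ?; exists n.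
Qed.

(** The closed sets A true and A false require the n-th digit of c to be the given
one whenever x is r-close to z n.  They cover X * C because x is close to at most
one z n, and their intersection lies over the points close to no z n.  Above z n
they contain sequences that differ in the n-th digit only. *)
Lemma totally_bounded_of_straight_cantor :
  straight (sum_prod X (metric_cantor R)) -> totally_bounded X.
Proof.
move=> sXC; apply: contrapT => /separated_sequence[e e0 [z zsep]].
pose r := e / 2; have r0 : 0 < r by rewrite divr_gt0.
pose A (b : bool) : set (sum_prod X (metric_cantor R)) :=
  [set p | forall n, mdist p.1 (z n) < r -> p.2 n = b].
have zuniq x m n : mdist x (z m) < r -> mdist x (z n) < r -> m = n.
  move=> xm xn; apply/eqP; apply: contraT => /zsep; rewrite leNgt => /negP[].
  apply: le_lt_trans (metric_triangle _ x _) _.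
  by rewrite [e]splitr ltrD// metric_sym.
have cA b : closed (A b).
  rewrite -openC; apply/openP_mdist => -[x c] /existsNP[n /not_implyP[/= xn cn]].
  have s0 : 0 < Num.min (r - mdist x (z n)) (2^-1 ^+ n).
    by rewrite lt_min subr_gt0 xn exprn_gt0.
  exists (Num.min (r - mdist x (z n)) (2^-1 ^+ n)) => // -[x' c'].
  rewrite mdist_sumE /= lt_min => /andP[xx' cc'] /(_ n) /= h.
  have cn' : c n = c' n.
    apply/eqP; apply: contraTT cc' => /cantor_dist_ge cc'; rewrite -leNgt.
    by rewrite ler_wpDl ?mdist_ge0// cc'.
  apply: cn; rewrite cn'; apply: h.
  have := metric_triangle x' x (z n); rewrite (metric_sym x' x).
  by have := mdist_ge0 c c'; lra.
have AT : A true `|` A false = setT.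
  apply/seteqP; split=> // -[x c] _.
  have [[n xn]|nx] := pselect (exists n, mdist x (z n) < r).
    have cx : A (c n) (x, c) by move=> m /= xm; rewrite (zuniq x m n).
    by case: (c n) cx => ?; [left|right].
  by left => n /= xn; case: nx; exists n.
have [d d0 Ad] := straight_uplaced sXC (cA true) (cA false) AT r0.
have [n nd] := exp_half_lt d0.
have [|||[x c] [/(_ n)/= xt /(_ n)/= xf] xr] :=
    Ad (z n, (fun i => i == n) : metric_cantor R)
       (z n, (fun=> false) : metric_cantor R).
- move=> m /= nm; apply/eqP/esym; apply: (zuniq (z n)) => //.
  by rewrite mdistxx.
- by [].
- rewrite mdist_sumE /= mdistxx add0r.
  apply: le_lt_trans nd; apply: cantor_dist_le => i ni.
  by apply/negbTE; rewrite neq_ltn ni.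
have xn : mdist x (z n) < r.
  rewrite metric_sym; apply: le_lt_trans xr.
  by rewrite mdist_sumE /= lerDl mdist_ge0.
by move: (xt xn); rewrite xf.
Qed.

(** The sets P such that P and U `\` P are open cut out on an open set U its clopen
subsets. *)
Definition quasi_component (U : set X) (x : X) : set X :=
  [set y | forall P, open P -> open (U `\` P) -> P x -> P y].

Lemma quasi_component_sub U x : open U -> U x -> quasi_component U x `<=` U.
Proof.
by move=> oU Ux y; apply => //; rewrite setDv; exact: open0.
Qed.

(** An open quasi-component Q is clopen in U, so a clopen part B of Q is clopen in
U as well, and Q cannot meet both B and U `\` B. *)
Lemma connected_quasi_component U x : open U -> U x ->
  open (quasi_component U x) -> connected (quasi_component U x).
Proof.
move=> oU Ux oQ; set Q := quasi_component U x.
have QU : Q `<=` U by exact: quasi_component_sub.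
have oUQ : open (U `\` Q).
  rewrite openE => y [Uy /existsNP[P]].
  move=> /not_implyP[oP /not_implyP[oUP /not_implyP[Px Py]]].
  apply: filterS (open_nbhs_nbhs (conj oUP (conj Uy Py))) => w [Uw Pw].
  by split=> // /(_ P oP oUP Px).
move=> B [w Bw] [C oC BC] [D cD BD].
have oB : open B by rewrite BC; exact: openI.
have BQ : B `<=` Q by rewrite BC; exact: subIsetl.
have oUB : open (U `\` B).
  have -> : U `\` B = (U `\` Q) `|` (Q `\` D).
    rewrite {1}BD; apply/seteqP; split=> y.
      move=> [Uy QDy].
      by have [Qy|] := pselect (Q y); [right|left]; split=> // Dy; apply: QDy.
    by move=> [[Uy Qy]|[Qy Dy]]; split=> [|[]]//; exact: QU.
  by apply: openU => //; rewrite setDE; apply: openI; [|exact: closed_openC].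
have [Bx|Bx] := pselect (B x).
  by apply/seteqP; split=> // y /(_ B oB oUB Bx).
have UUB : U `\` (U `\` B) = B.
  by rewrite setDD; apply/setIidPr; exact: subset_trans QU.
have : (U `\` B) w.
  by apply: (BQ _ Bw) => //; rewrite UUB.
by case.
Qed.

(** If P is open with open complement in the ball U around x, then the complements
of P and of U `\` P form a closed cover of X whose intersection avoids U.  Were
there such P and arbitrarily close x in P and y not in P, a sequence of these
covers would give on the layers of X * nat a closed cover that is not
u-placed. *)
Lemma quasi_component_near_of_straight_nat :
  straight (sum_prod X (metric_nat R)) -> forall e : R, 0 < e ->
    exists2 d : R, 0 < d &
      forall x y, mdist x y < d -> quasi_component (ball x e) x y.
Proof.
move=> sXN e e0; apply: contrapT => nd.
have bad n : exists w : X * X * set X,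
    [/\ mdist w.1.1 w.1.2 < n.+1%:R^-1, open w.2,
        open (ball w.1.1 e `\` w.2), w.2 w.1.1 & ~ w.2 w.1.2].
  apply: contrapT => nbad; apply: nd; exists n.+1%:R^-1; first by [].
  move=> x y xy P oP oUP Px; apply: contrapT => Py; apply: nbad.
  by exists (x, y, P).
have [w /all_and5[wd oP oUP Px Py]] := choice bad.
pose A : set (sum_prod X (metric_nat R)) :=
  [set p | ~ (ball (w p.2).1.1 e `\` (w p.2).2) p.1].
pose B : set (sum_prod X (metric_nat R)) := [set p | ~ (w p.2).2 p.1].
have closed_layers (V : nat -> set X) : (forall n, open (V n)) ->
    closed [set p : sum_prod X (metric_nat R) | ~ V p.2 p.1].
  move=> oV; rewrite -openC; apply/openP_mdist => -[x n] /= /contrapT Vx.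
  have /openP_mdist/(_ x Vx)[d d0 Vd] := oV n.
  exists (Num.min d 1) => [|[y m]]; first by rewrite lt_min d0 ltr01.
  rewrite mdist_sumE /= lt_min => /andP[xyd nm1] /=.
  have <- : n = m.
    apply/eqP; apply: contraTT nm1 => nm; rewrite -leNgt.
    by rewrite ler_wpDl ?mdist_ge0// mdist_nat_ge1.
  apply; apply: Vd; apply: le_lt_trans xyd.
  by rewrite lerDl mdist_ge0.
have AB : A `|` B = setT.
  apply/seteqP; split=> // -[x n] _ /=.
  by have [Px'|] := pselect ((w n).2 x); [left => -[]|right].
(* a distance below 1 in X * nat keeps the layer fixed *)
have m0 : 0 < Num.min e 1 by rewrite lt_min e0 ltr01.
have [d d0 Ad] := straight_uplaced sXN (closed_layers _ oUP)
  (closed_layers _ oP) AB m0.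
have [n ninv] : exists n : nat, n.+1%:R^-1 < d.
  exists (Num.truncn d^-1); rewrite -[ltRHS]invrK ltf_pV2 ?posrE ?invr_gt0//.
  exact: truncnS_gt.
have [|||[z m] [/= zA zB]] := Ad ((w n).1.1, n) ((w n).1.2, n).
- by case.
- exact: Py.
- rewrite mdist_sumE /= mdistxx addr0; exact: lt_trans (wd n) ninv.
rewrite mdist_sumE /= lt_min => /andP[zn zn1].
have mn : m = n.
  apply/esym/eqP; apply: contraTT zn1 => nm; rewrite -leNgt.
  by rewrite ler_wpDl ?mdist_ge0// mdist_nat_ge1.
rewrite mn in zA zB zn; apply: zA; split=> //.
by rewrite ballEmdist /=; apply: le_lt_trans zn; rewrite lerDl mdist_ge0.
Qed.

(** The quasi-component of x in U is open: if y belongs to it and a ball around y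
lies in U, then the points close to y belong to the quasi-component of y in this
ball, a fortiori to that of x in U. *)
Lemma ulc_of_straight_nat :
  straight (sum_prod X (metric_nat R)) -> uniformly_locally_connected X.
Proof.
move=> /quasi_component_near_of_straight_nat near_qc e e0.
have r0 : 0 < e / 3 by rewrite divr_gt0.
have [d d0 dqc] := near_qc _ r0; exists d => // x y /dqc xy.
have oU : open (ball x (e / 3)) by exact: open_mball.
have Ux : ball x (e / 3) x by exact: ballxx.
have QU := quasi_component_sub oU Ux.
exists (quasi_component (ball x (e / 3)) x); split=> //.
- apply: connected_quasi_component => //; apply/openP_mdist => y' Qy'.
  have /openP_mdist/(_ y' (QU _ Qy'))[s s0 sU] := oU.
  have [t t0 tqc] := near_qc s s0; exists t => // z /tqc y'z P oP oUP Px.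
  apply: (y'z P oP) (Qy' P oP oUP Px).
  have -> : ball y' s `\` P = ball y' s `&` (ball x (e / 3) `\` P).
    rewrite setIDA; congr (_ `\` _); apply/esym/setIidPl => u.
    by rewrite ballEmdist; exact: sU.
  by apply: openI => //; exact: open_mball.
- apply: (@le_lt_trans _ _ (e / 3 * 2)%:E); last by rewrite lte_fin; lra.
  apply: ub_ereal_sup => _ [u /QU xu [v /QU xv <-]].
  rewrite lee_fin; apply: le_trans (metric_triangle _ x _) _.
  move: xu xv; rewrite !ballEmdist /= (metric_sym u x); lra.
Qed.
End Necessity.

(** * The equivalence *)

Theorem corollary5p10 (R : realType) (X : metricType R) :
  [<-> (forall Y : metricType R, straight Y -> straight (sum_prod X Y));
       (forall Y : metricType R, metric_complete Y -> straight Y ->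
          straight (sum_prod X Y));
       (straight (sum_prod X (metric_cantor R)) /\
        straight (sum_prod X (metric_nat R)));
       (totally_bounded X /\ uniformly_locally_connected X)].
Proof.
tfae.
- by move=> sXY Y _; exact: sXY.
- move=> sXY; split; apply: sXY.
  + exact: metric_complete_cantor.
  + exact/compact_straight/metric_cantor_compact.
  + exact: metric_complete_nat.
  + exact: straight_nat.
- move=> [sXC sXN]; split.
  + exact: totally_bounded_of_straight_cantor.
  + exact: ulc_of_straight_nat.
- by move=> [tbX ulcX] Y; exact: straight_prod.
Qed.
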